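(* For every integer $n>0$ there are $(F,\mathrm{Frob})\in\mathcal{S}$, an element $a_n\in F$ and a tuple $b_n$ from $F$ such that $a_n$ belongs to the definable closure of $b_n$ in $(F,\mathrm{Frob})$ (in the language $\mathcal{L}_\sigma$), but $\deg_\sigma(a_n/b_n)=n$.
   Context: $\mathbb{P}$ = primes, $\mathrm{Frob}_p:x\mapsto x^p$, $\mathcal{L}_\sigma$ = language of rings plus unary $\sigma$. For a parameter-free $\mathcal{L}_\sigma$-formula $\varphi$ and prime $p$, $\varphi_p$ replaces each $\sigma(t)$ by $t^p$. For each ring formula $\psi(x,y)$, $|x|=n$, fix $C_\psi>0$ and finite $D_\psi\subseteq\{0,..,n\}\times\mathbb{R}^{>0}$ such that for all finite fields $\mathbb{F}_q$ and $a$ with $\psi(\mathbb{F}_q^n,a)\ne\emptyset$ some $(d,\mu)\in D_\psi$ has $\big||\psi(\mathbb{F}_q^n,a)|-\mu q^d\big|\le C_\psi q^{d-1/2}$; $E_\psi=\{\mu:(d,\mu)\in D_\psi\}$; $N^p_\varphi=\max\{\mu,1/\mu,2\log_p(2C_{\varphi_p}/\mu):\mu\in E_{\varphi_p}\}$; $f(\ell,p)=\max\{N^p_\varphi:|\varphi|\le\ell\}$. $\mathcal{S}$ = ultraproducts $\prod_{p}(\mathbb{F}_{p^{k_p}},\mathrm{Frob}_p)/\mathcal{U}$, $\mathcal{U}$ non-principal on $\mathbb{P}$, $k_p\ge f(p,p)$. In a difference field, for a difference subfield $E$ and tuple $a$, $\deg_\sigma(a/E)$ is the transcendence degree over $E$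 of the smallest difference field containing $E\cup a$ closed under $\sigma,\sigma^{-1}$; $\deg_\sigma(a/b)$ means $\deg_\sigma(a/E)$ for $E$ the difference field generated by $b$. *)

(* Defs.v *)
From Stdlib Require Import Reals.
From Stdlib Require List.
From mathcomp Require Import all_boot ssralg finalg.

Set Implicit Arguments.
Unset Strict Implicit.
Unset Printing Implicit Defensive.

Inductive term : Type :=
  | tvar of nat
  | tzero | tone
  | tadd of term & term
  | topp of term
  | tmul of term & term
  | tsig of term.

Inductive formula : Type :=
  | feq of term & term
  | ffalse
  | fnot of formula
  | fand of formula & formula
  | f_or of formula & formula
  | fimp of formula & formula
  | fall of nat & formula
  | fex of nat & formula.

Fixpoint tsize (t : term) : nat :=
  match t with
  | tvar i => i.+1
  | tzero | tone => 1
  | tadd u v | tmul u v => (tsize u + tsize v).+1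
  | topp u | tsig u => (tsize u).+1
  end.

Fixpoint fsize (f : formula) : nat :=
  match f with
  | feq u v => (tsize u + tsize v).+1
  | ffalse => 1
  | fnot g => (fsize g).+1
  | fand g h | f_or g h | fimp g h => (fsize g + fsize h).+1
  | fall i g | fex i g => (i.+1 + fsize g).+1
  end.

Fixpoint tfv (t : term) : seq nat :=
  match t with
  | tvar i => [:: i]
  | tzero | tone => [::]
  | tadd u v | tmul u v => tfv u ++ tfv v
  | topp u | tsig u => tfv u
  end.

Fixpoint ffv (f : formula) : seq nat :=
  match f with
  | feq u v => tfv u ++ tfv v
  | ffalse => [::]
  | fnot g => ffv g
  | fand g h | f_or g h | fimp g h => ffv g ++ ffv h
  | fall i g | fex i g => filter (predC1 i) (ffv g)
  end.

Fixpoint tring (t : term) : bool :=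
  match t with
  | tvar _ | tzero | tone => true
  | tadd u v | tmul u v => tring u && tring v
  | topp u => tring u
  | tsig _ => false
  end.

Fixpoint fring (f : formula) : bool :=
  match f with
  | feq u v => tring u && tring v
  | ffalse => true
  | fnot g => fring g
  | fand g h | f_or g h | fimp g h => fring g && fring h
  | fall _ g | fex _ g => fring g
  end.

Definition tpowt (u : term) (p : nat) : term := iter p.-1 (tmul u) u.

Fixpoint tfrob (p : nat) (t : term) : term :=
  match t with
  | tvar i => tvar i
  | tzero => tzero
  | tone => tone
  | tadd u v => tadd (tfrob p u) (tfrob p v)
  | topp u => topp (tfrob p u)
  | tmul u v => tmul (tfrob p u) (tfrob p v)
  | tsig u => tpowt (tfrob p u) p
  end.

Fixpoint ffrob (p : nat) (f : formula) : formula :=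
  match f with
  | feq u v => feq (tfrob p u) (tfrob p v)
  | ffalse => ffalse
  | fnot g => fnot (ffrob p g)
  | fand g h => fand (ffrob p g) (ffrob p h)
  | f_or g h => f_or (ffrob p g) (ffrob p h)
  | fimp g h => fimp (ffrob p g) (ffrob p h)
  | fall i g => fall i (ffrob p g)
  | fex i g => fex i (ffrob p g)
  end.

(* A formula psi(x,y) with |x| = pn, |y| = pm: x = variables 0..pn-1,
   y = variables pn..pn+pm-1. *)
Record pform := PForm { pn : nat; pm : nat; pf : formula }.

Definition pwf (psi : pform) : bool :=
  all (fun i => i < pn psi + pm psi) (ffv (pf psi)).

Definition plen (psi : pform) : nat := fsize (pf psi) + pn psi + pm psi.

Definition pfrob (p : nat) (psi : pform) : pform :=
  PForm (pn psi) (pm psi) (ffrob p (pf psi)).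

Record Lstruct := LStruct {
  car :> Type;
  req : car -> car -> Prop;
  r0 : car; r1 : car;
  radd : car -> car -> car;
  rmul : car -> car -> car;
  ropp : car -> car;
  rinv : car -> car;   (* not in the language; used to generate subfields *)
  rsig : car -> car }.

Fixpoint teval (M : Lstruct) (e : nat -> M) (t : term) : M :=
  match t with
  | tvar i => e i
  | tzero => r0 M
  | tone => r1 M
  | tadd u v => radd (teval e u) (teval e v)
  | topp u => ropp (teval e u)
  | tmul u v => rmul (teval e u) (teval e v)
  | tsig u => rsig (teval e u)
  end.

Definition upd (M : Lstruct) (e : nat -> M) (i : nat) (c : M) : nat -> M :=
  fun j => if j == i then c else e j.

Fixpoint sat (M : Lstruct) (e : nat -> M) (f : formula) : Prop :=
  match f with
  | feq u v => req (teval e u) (teval e v)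
  | ffalse => False
  | fnot g => ~ sat e g
  | fand g h => sat e g /\ sat e h
  | f_or g h => sat e g \/ sat e h
  | fimp g h => sat e g -> sat e h
  | fall i g => forall c : M, sat (upd e i c) g
  | fex i g => exists c : M, sat (upd e i c) g
  end.

Definition envs (M : Lstruct) (s : seq M) : nat -> M := fun i => nth (r0 M) s i.

Definition fstruct (F : finFieldType) (s : F -> F) : Lstruct :=
  @LStruct F (@eq F) (@GRing.zero F) (@GRing.one F) (@GRing.add F) (@GRing.mul F)
    (@GRing.opp F) (@GRing.inv F) s.

(* C and D satisfy the Chatzidakis--van den Dries--Macintyre estimates
   for every ring formula psi(x,y) *)
Definition valid_CD (C : pform -> R) (D : pform -> list (nat * R)) : Prop :=
  forall psi : pform, pwf psi -> fring (pf psi) ->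
    Rlt 0 (C psi) /\
    (forall d mu, List.In (d, mu) (D psi) -> (d <= pn psi)%N /\ Rlt 0 mu) /\
    forall (F : finFieldType) (a : (pm psi).-tuple F),
      (exists x : {ffun 'I_(pn psi) -> F},
          sat (envs (M := @fstruct F id) (map x (enum 'I_(pn psi)) ++ a)) (pf psi)) ->
      exists d mu, List.In (d, mu) (D psi) /\
        exists S : {set {ffun 'I_(pn psi) -> F}},
          (forall x, x \in S <->
             sat (envs (M := @fstruct F id) (map x (enum 'I_(pn psi)) ++ a)) (pf psi)) /\
          Rle (Rabs (Rminus (INR #|S|) (Rmult mu (pow (INR #|F|) d))))
              (Rmult (C psi) (Rpower (INR #|F|) (Rminus (INR d) (Rinv 2)))).

(* k >= f(l,p), i.e. k >= N^p_phi for every phi with |phi| <= l *)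
Definition ge_f (C : pform -> R) (D : pform -> list (nat * R)) (l p k : nat) : Prop :=
  forall phi : pform, pwf phi -> (plen phi <= l)%N ->
    forall d mu, List.In (d, mu) (D (pfrob p phi)) ->
      Rle mu (INR k) /\ Rle (Rinv mu) (INR k) /\
      Rle (Rmult 2 (Rdiv (ln (Rdiv (Rmult 2 (C (pfrob p phi))) mu)) (ln (INR p))))
          (INR k).

Definition primeT := {p : nat | prime p}.

Definition ultrafilter (I : Type) (U : (I -> Prop) -> Prop) : Prop :=
  U (fun _ => True) /\ ~ U (fun _ => False) /\
  (forall A B : I -> Prop, U A -> (forall i, A i -> B i) -> U B) /\
  (forall A B : I -> Prop, U A -> U B -> U (fun i => A i /\ B i)) /\
  (forall A : I -> Prop, U A \/ U (fun i => ~ A i)).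

Definition nonprincipal (I : Type) (U : (I -> Prop) -> Prop) : Prop :=
  forall i0 : I, ~ U (fun i => i = i0).

(* prod_p (F p, Frob_p) / U ; equality is U-almost-everywhere equality *)
Definition ustruct (F : primeT -> finFieldType) (U : (primeT -> Prop) -> Prop)
  : Lstruct :=
  @LStruct (forall p, F p)
    (fun x y => U (fun p => x p = y p))
    (fun p => @GRing.zero (F p)) (fun p => @GRing.one (F p))
    (fun x y p => GRing.add (x p) (y p))
    (fun x y p => GRing.mul (x p) (y p))
    (fun x p => GRing.opp (x p))
    (fun x p => GRing.inv (x p))
    (fun x p => GRing.exp (x p) (val p)).

Definition dcl (M : Lstruct) (b : seq M) (a : M) : Prop :=
  exists phi : formula,
    pwf (PForm 1 (size b) phi) /\
    sat (envs (a :: b)) phi /\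
    forall a' : M, sat (envs (a' :: b)) phi -> req a' a.

Definition diff_subfield (M : Lstruct) (X : M -> Prop) : Prop :=
  (forall x y, req x y -> X x -> X y) /\
  X (r0 M) /\ X (r1 M) /\
  (forall x y, X x -> X y -> X (radd x y)) /\
  (forall x y, X x -> X y -> X (rmul x y)) /\
  (forall x, X x -> X (ropp x)) /\
  (forall x, X x -> X (rinv x)) /\
  (forall x, X x -> X (rsig x)) /\
  (forall x, X (rsig x) -> X x).

Definition gen_diff (M : Lstruct) (S : M -> Prop) : M -> Prop :=
  fun x => forall X, diff_subfield X -> (forall s, S s -> X s) -> X x.

Definition rpow (M : Lstruct) (x : M) (k : nat) : M := iter k (rmul x) (r1 M).

Definition alg_indep (M : Lstruct) (E : M -> Prop) (k : nat) (c : 'I_k -> M) : Prop :=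
  forall (N : nat) (coef : {ffun 'I_k -> 'I_N.+1} -> M),
    (forall al, E (coef al)) ->
    req (\big[@radd M / r0 M]_(al : {ffun 'I_k -> 'I_N.+1})
           rmul (coef al) (\big[@rmul M / r1 M]_(i < k) rpow (c i) (al i)))
        (r0 M) ->
    forall al, req (coef al) (r0 M).

Definition trdeg_eq (M : Lstruct) (E K : M -> Prop) (n : nat) : Prop :=
  (exists c : 'I_n -> M, (forall i, K (c i)) /\ alg_indep E c) /\
  (forall c : 'I_n.+1 -> M, (forall i, K (c i)) -> ~ alg_indep E c).

Definition deg_sigma_eq (M : Lstruct) (a : M) (b : seq M) (n : nat) : Prop :=
  trdeg_eq (gen_diff (fun x => List.In x b))
           (gen_diff (fun x => x = a \/ List.In x b)) n.

(* Main.v *)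
(* With [N = p^n - 2], take for [a] an element of [F_(p^k)] that is a root of no
   nonzero polynomial of size at most [p^p] over [F_p], and [b = a^N], so that
   [sigma^n a = b a^2].  When [k = n (j + 1)] with [j] a multiple of the order
   of 2 modulo [N], a solution [u != 0] of [u^(p^n) = u^2] satisfies both
   [u = u^(2^(j+1))] and [u^(2^j - 1) = 1], so [u = 1], and [a] is the only
   nonzero [x] with [sigma^n x = b x^2].

   Every element of the difference field [E] of [b] is, up to a power of
   Frobenius, a fraction of polynomials in [a^N] of standard height [p^s].  The
   monomials of bounded degree in [a, sigma a, ..., sigma^(n-1) a] are powers of
   [a] whose exponents, read in base [p], are pairwise distinct modulo [N] (and
   remain so after multiplication by powers of [p]); hence no relation over [E]
   holds between these [n] elements, by comparing coefficients in [F_p[X]].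
   Conversely, up to a power of Frobenius every element of the difference field
   of [a, b] is a fraction in [a, ..., sigma^(n-1) a] over [E], and counting
   monomials shows that any [n + 1] such elements are dependent over [E]. *)
Require Import Defs.
From Stdlib Require Import Reals.
From Stdlib Require List.
From mathcomp Require Import all_boot ssralg finalg.
From mathcomp Require Import matrix mxpoly poly zmodp cyclic finfield.
From mathcomp Require Import boolp classical_sets filter.
From mathcomp Require Import zify ring.

Set Implicit Arguments.
Unset Strict Implicit.
Unset Printing Implicit Defensive.

Import GRing.Theory.
Local Open Scope nat_scope.

(** * Base-[p] digits and arithmetic modulo [p ^ n - 2] *)

Lemma digit_sum_ltn p n (al : 'I_n -> nat) :
  (forall i, al i < p) -> \sum_(i < n) al i * p ^ i < p ^ n.
Proof.
elim: n al => [|n IHn] al lt_al; first by rewrite big_ord0.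
rewrite big_ord_recr /= expnS.
have := IHn (fun i => al (widen_ord (leqnSn n) i)) (fun i => lt_al _).
have := lt_al ord_max; rewrite /=; nia.
Qed.

Lemma digit_sum_inj p n (al be : 'I_n -> nat) :
    (forall i, al i < p) -> (forall i, be i < p) ->
  \sum_(i < n) al i * p ^ i = \sum_(i < n) be i * p ^ i -> al =1 be.
Proof.
elim: n al be => [|n IHn] al be lt_al lt_be; first by move=> _ [].
rewrite !big_ord_recr /=.
have := digit_sum_ltn (fun i => lt_al (widen_ord (leqnSn n) i)).
have := digit_sum_ltn (fun i => lt_be (widen_ord (leqnSn n) i)).
set s := \sum_(i < n) _; set t := \sum_(i < n) _ => /= lt_s lt_t eq_st.
have [eq_max eq_low] : al ord_max = be ord_max /\ t = s.
  by have [] := ltngtP (al ord_max) (be ord_max); nia.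
move=> i; have [j ->|->] := unliftP ord_max i; last by [].
have -> : lift ord_max j = widen_ord (leqnSn n) j.
  by apply: val_inj; rewrite /= /bump leqNgt ltn_ord.
by apply: (IHn _ _ _ _ eq_low) => k.
Qed.

(* With all digits below [p - 2], adding 2 to the lowest one still gives [n]
   digits below [p]. *)
Lemma small_digit_sum_ltn p n (al : 'I_n -> nat) : 0 < n ->
  (forall i, al i + 2 < p) -> \sum_(i < n) al i * p ^ i < p ^ n - 2.
Proof.
case: n al => // n al _ lt_al.
have : \sum_(i < n.+1) (al i + 2 * (i == ord0)) * p ^ i < p ^ n.+1.
  by apply: digit_sum_ltn => i; have := lt_al i; case: eqP => _; lia.
rewrite !big_ord_recl /= expn0.
under [X in _ + X < _ -> _]eq_bigr => i _ do rewrite muln0 addn0.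
lia.
Qed.

(** A common divisor of [p] and [p ^ n - 2] divides [p ^ n - (p ^ n - 2) = 2], and [p] is odd. *)
Lemma coprime_expn_sub2 p n m :
  odd p -> 1 < p -> 0 < n -> coprime (p ^ m) (p ^ n - 2).
Proof.
move=> p_odd p_gt1 n_gt0; case: m => [|m]; first by rewrite coprime1n.
rewrite coprime_pexpl // coprime_sym.
have p_gt2 : 2 < p by lia.
have le2 : 2 <= p ^ n by rewrite (leq_trans (ltnW p_gt2)) // -{1}(expn1 p) leq_exp2l.
have : coprime (p ^ n - (p ^ n - 2)) p.
  by rewrite subKn // coprime2n.
move=> co2; rewrite /coprime -dvdn1.
have d_p := dvdn_gcdr (p ^ n - 2) p; have d_N := dvdn_gcdl (p ^ n - 2) p.
have d_pn : gcdn (p ^ n - 2) p %| p ^ n by apply: dvdn_exp.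
rewrite -[X in _ %| X](eqP co2) dvdn_gcd d_p andbT.
exact: dvdn_sub.
Qed.

(** By coprimality [p ^ m] cancels modulo [p ^ n - 2], and both numbers are already reduced. Hence a
    power of Frobenius never merges two exponent classes. *)
Lemma mulp_mod_inj p n m x y :
    odd p -> 1 < p -> 0 < n -> x < p ^ n - 2 -> y < p ^ n - 2 ->
  p ^ m * x = p ^ m * y %[mod p ^ n - 2] -> x = y.
Proof.
move=> p_odd p_gt1 n_gt0; wlog le_yx : x y / y <= x => [IH lt_x lt_y eqxy|].
  case: (leqP y x) => [le|/ltnW le]; first exact: IH.
  by apply/esym/IH => //; apply/esym.
move=> lt_x lt_y /eqP; rewrite eqn_mod_dvd ?leq_mul2l ?le_yx ?orbT //.
rewrite -mulnBr Gauss_dvdr; last by rewrite coprime_sym coprime_expn_sub2.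
case: (posnP (x - y)) => [|gt0 /(dvdn_leq gt0)]; lia.
Qed.

(** * Finite fields and polynomials over their prime field *)

Section FiniteFields.
Local Open Scope ring_scope.

(** The order of [u] divides [p ^ n - 2], and the [n]-th power of Frobenius squares [u]. The
    identity, being the [n * j.+1]-th power of Frobenius, therefore raises [u] to the power
    [2 ^ j.+1]; since [2 ^ j] is 1 modulo the odd number [p ^ n - 2] by Euler, this gives
    [u = u ^+ 2]. *)
Lemma expf_p_eq_sqr (F : finFieldType) p n j (u : F) :
    odd p -> (1 < p)%N -> (0 < n)%N -> #|F| = (p ^ (n * j.+1))%N ->
    (totient (p ^ n - 2) %| j)%N -> u != 0 -> u ^+ (p ^ n) = u ^+ 2 -> u = 1.
Proof.
move=> p_odd p_gt1 n_gt0 cardF dvd_j u_neq0 eq_u.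
have p_gt2 : (2 < p)%N by lia.
have le2 : (2 < p ^ n)%N.
  by rewrite (leq_trans p_gt2) // -{1}(expn1 p) leq_exp2l.
have uN : u ^+ (p ^ n - 2) = 1.
  apply: (mulIf (expf_neq0 2 u_neq0)).
  by rewrite -exprD subnK ?mul1r // ltnW.
have u2j i : u ^+ (p ^ (n * i)) = u ^+ (2 ^ i).
  elim: i => [|i IHi]; first by rewrite muln0.
  by rewrite mulnS expnD exprM eq_u -exprM mulnC exprM IHi -exprM -expnSr.
have : (2 ^ j == 1 %[mod p ^ n - 2])%N.
  case/dvdnP: dvd_j => i ->; rewrite mulnC expnM -modnXm Euler_exp_totient.
    by rewrite modnXm exp1n.
  by rewrite coprime2n oddB ?(ltnW le2) // oddX p_odd orbT.
rewrite eqn_mod_dvd ?expn_gt0 // => /dvdnP[q eq_q].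
have u2 : u ^+ (2 ^ j) = u.
  have -> : (2 ^ j = (p ^ n - 2) * q + 1)%N.
    by rewrite mulnC -eq_q subnK // expn_gt0.
  by rewrite exprD exprM uN expr1n mul1r.
have := u2j j.+1; rewrite -cardF expf_card expnSr exprM u2.
by move/esym/(canRL (mulfK u_neq0)); rewrite mulfV.
Qed.

Lemma rmorph_Fp (F : finFieldType) p : p \in [pchar F] ->
  exists iota : {rmorphism 'F_p -> F}, True.
Proof.
move=> pF.
pose f : {rmorphism 'F_p -> pPrimeCharType pF} := GRing.in_alg (pPrimeCharType pF).
by exists f.
Qed.

(* The product of all nonzero polynomials of size at most [d] over the small
   field has fewer roots than the big field has elements. *)
Lemma exists_not_root (K F : finFieldType) (iota : {rmorphism K -> F}) d :
    (d * #|K| ^ d < #|F|)%N ->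
  exists a : F, forall P : {poly K},
    P != 0 -> (size P <= d)%N -> (map_poly iota P).[a] != 0.
Proof.
move=> ltF.
pose G := \prod_(v : 'rV[K]_d | v != 0) map_poly iota (rVpoly v).
have nzv (v : 'rV[K]_d) : v != 0 -> map_poly iota (rVpoly v) != 0.
  rewrite map_poly_eq0; apply: contraNneq => eq0.
  by rewrite -[v]rVpolyK eq0 linear0.
have nzG : G != 0 by apply/prodf_neq0 => v /nzv.
have szG : (size G <= #|F|)%N.
  apply: leq_trans (size_poly_prod_leq _ _) _.
  apply: leq_trans (leq_subr _ _) _.
  apply: leq_ltn_trans ltF.
  apply: (@leq_trans (\sum_(v : 'rV[K]_d | v != 0%R) d)).
    by apply: leq_sum => v _; rewrite size_map_poly size_poly.
  rewrite sum_nat_const mulnC leq_mul2l (leq_trans (max_card _)) ?orbT //.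
  by rewrite card_mx mul1n.
have [a] : exists a, ~~ root G a.
  apply/existsP; rewrite -negb_forall; apply: contraL szG => /forallP rootG.
  rewrite -ltnNge cardE (max_poly_roots nzG) ?enum_uniq //.
  by apply/allP => x _; apply: rootG.
rewrite /root horner_prod => /prodf_neq0 nra; exists a => P nzP szP.
have eqP : rVpoly (poly_rV P : 'rV_d) = P by apply: poly_rV_K.
rewrite -eqP; apply: nra; apply: contraNneq nzP => eq0.
by rewrite -eqP eq0 linear0.
Qed.

(** All exponents in the [i]-th term are congruent to [e i] modulo [N], so no two terms share a
    monomial: the coefficient of the sum at [N * t + e i] is that of [H i] at [t]. *)
Lemma graded_sum_eq0 (R : nzRingType) (I : finType) N (H : I -> {poly R}) e :
    (0 < N)%N -> (forall i j, e i = e j %[mod N] -> i = j) ->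
    \sum_i (H i \Po 'X^N) * 'X^(e i) = 0 ->
  forall i, H i = 0.
Proof.
move=> N_gt0 inj_e sum0 i; apply/polyP => t.
rewrite coef0; move/(congr1 (fun P : {poly R} => P`_(N * t + e i))): sum0.
rewrite coef_sum coef0 (bigD1 i) //= coefMXn ltnNge leq_addl addnK.
rewrite coef_comp_poly_Xn // dvdn_mulr // mulKn // big1 ?addr0 // => j ne_ji.
rewrite coefMXn; case: ltnP => // le_j; rewrite coef_comp_poly_Xn //.
rewrite -eqn_mod_dvd // mulnC modnMDl; case: eqP => // /inj_e eq_ij.
by rewrite eq_ij eqxx in ne_ji.
Qed.

(** A crude multiplicative bound, suited to sizes that are bounded by powers of [p]. *)
Lemma size_mul_leq_mul (R : nzRingType) (P Q : {poly R}) (A B : nat) :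
  (size P <= A)%N -> (size Q <= B)%N -> (0 < A)%N -> (0 < B)%N ->
  (size (P * Q)%R <= A * B)%N.
Proof. by move=> leA leB A0 B0; apply: leq_trans (size_polyMleq _ _) _; nia. Qed.

Lemma size_prod_leq_exp (R : idomainType) (I : finType) (A : nat) (P : pred I)
    (Q : I -> {poly R}) :
  (0 < A)%N -> (forall i, size (Q i) <= A)%N ->
  (size (\prod_(i | P i) Q i)%R <= A ^ #|P|)%N.
Proof.
move=> A_gt0 leQ; rewrite -sum1_card.
apply: (big_ind2 (fun (q : {poly R}) k => size q <= A ^ k)%N) => [|q k q' k'|i _].
- by rewrite size_poly1.
- by move=> leq leq'; rewrite expnD size_mul_leq_mul ?expn_gt0 ?A_gt0.
- by rewrite expn1.
Qed.

End FiniteFields.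

(** * Finiteness of the set of formulas of bounded length, and the lower bound on degrees *)

Definition listable T (P : T -> Prop) := exists s : list T, forall x, P x -> List.In x s.

Lemma in_map_pair (A B T : Type) (f : A -> B -> T) (s : list A) (t : list B) x y :
  List.In x s -> List.In y t ->
  List.In (f x y) (List.map (fun xy => f xy.1 xy.2) (List.list_prod s t)).
Proof.
move=> xs yt; apply: (List.in_map (fun xy => f xy.1 xy.2) _ (x, y)).
exact: List.in_prod.
Qed.

Lemma in_seq0 i l : i < l -> List.In i (List.seq 0 l).
Proof. by move=> lt_il; apply/List.in_seq; lia. Qed.

Ltac in_cat :=
  first [ by apply: List.in_map; auto | by apply: in_map_pair; auto
        | by left | apply/List.in_app_iff; left; in_cat
        | apply/List.in_app_iff; right; in_cat].

(** The size of a variable counts its index, so only finitely many variables occur. *)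
Lemma listable_terms l : listable (fun t => Defs.tsize t <= l).
Proof.
elim: l => [|l [s in_s]]; first by exists nil; case.
exists (List.map tvar (List.seq 0 l.+1) ++ [:: tzero] ++ [:: tone] ++
  List.map topp s ++ List.map tsig s ++
  List.map (fun uv => tadd uv.1 uv.2) (List.list_prod s s) ++
  List.map (fun uv => tmul uv.1 uv.2) (List.list_prod s s))%list.
case=> [i| | |u v|u|u v|u] le_l; rewrite /= in le_l;
  try have ltil : List.In i (List.seq 0 l.+1) by apply: in_seq0.
all: try have us : List.In u s by apply: in_s; lia.
all: try have vs : List.In v s by apply: in_s; lia.
all: in_cat.
Qed.

Lemma listable_formulas l : listable (fun f => fsize f <= l).
Proof.
have [r in_r] := listable_terms l.
elim: l r in_r => [|l IHl] r in_r; first by exists nil; case.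
have [|s in_s] := IHl r; first by move=> t le_t; apply: in_r; lia.
exists ([:: ffalse] ++
  List.map (fun uv => feq uv.1 uv.2) (List.list_prod r r) ++
  List.map fnot s ++
  List.map (fun gh => fand gh.1 gh.2) (List.list_prod s s) ++
  List.map (fun gh => f_or gh.1 gh.2) (List.list_prod s s) ++
  List.map (fun gh => fimp gh.1 gh.2) (List.list_prod s s) ++
  List.map (fun ig => fall ig.1 ig.2) (List.list_prod (List.seq 0 l) s) ++
  List.map (fun ig => fex ig.1 ig.2) (List.list_prod (List.seq 0 l) s))%list.
case=> [u v||g|g h|g h|g h|i g|i g] le_l; rewrite /= in le_l.
all: try have ur : List.In u r by apply: in_r; lia.
all: try have vr : List.In v r by apply: in_r; lia.
all: try have gs : List.In g s by apply: in_s; lia.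
all: try have hs : List.In h s by apply: in_s; lia.
all: try have ltil : List.In i (List.seq 0 l) by apply: in_seq0; lia.
all: in_cat.
Qed.

Lemma listable_pform l : listable (fun psi => plen psi <= l).
Proof.
have [s in_s] := listable_formulas l.
have [I in_I] : listable (leq^~ l) by
  exists (List.seq 0 l.+1) => i le_il; exact: (@in_seq0 i l.+1 le_il).
exists (List.map (fun nmf => PForm nmf.1.1 nmf.1.2 nmf.2)
  (List.list_prod (List.list_prod I I) s)).
case=> n m f; rewrite /plen /= => le_l.
apply: (List.in_map (fun nmf => PForm nmf.1.1 nmf.1.2 nmf.2) _ (n, m, f)).
by do 2?[apply/List.in_prod_iff; split]; [apply: in_I|apply: in_I|apply: in_s]; lia.
Qed.

Lemma INR_bound (s : list R) :
  exists K : nat, forall k : nat, K <= k -> forall x, List.In x s -> Rle x (INR k).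
Proof.
elim: s => [|y s [K leK]]; first by exists 0.
have [K' ltK'] := INR_unbounded y.
exists (maxn K K') => k; rewrite geq_max => /andP[le_Kk le_K'k] x [<-|/leK]; last exact.
apply: Rle_trans (Rlt_le _ _ ltK') _; apply: le_INR; exact/leP.
Qed.

(** Finitely many formulas, each with a finite list of pairs [(d, mu)], impose only finitely many
    real lower bounds on [k]. *)
Lemma exists_ge_f C D l p : exists K, forall k, K <= k -> ge_f C D l p k.
Proof.
have [s in_s] := listable_pform l.
pose bounds phi (dmu : nat * R) := [:: dmu.2; Rinv dmu.2;
  Rmult 2 (Rdiv (ln (Rdiv (Rmult 2 (C (pfrob p phi))) dmu.2)) (ln (INR p)))].
have [K leK] := INR_bound (List.flat_map (fun phi =>
  List.flat_map (bounds phi) (D (pfrob p phi))) s).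
exists K => k /leK{}leK phi _ le_phi d mu in_D.
have bound x : List.In x (bounds phi (d, mu)) -> Rle x (INR k).
  move=> in_x; apply: leK; apply/List.in_flat_map; exists phi; split; first exact: in_s.
  by apply/List.in_flat_map; exists (d, mu).
by split; [|split]; apply: bound; rewrite /=; auto.
Qed.

(** * Ultraproducts, their difference subfields, and linear algebra over these *)

Section Ultraproduct.
Variables (F : primeT -> finFieldType) (U : (primeT -> Prop) -> Prop).
Hypothesis ultraU : ultrafilter U.
Local Notation M := (ustruct F U).
Local Notation prodF := (forall p : primeT, F p).
Local Open Scope ring_scope.

Lemma U_mono (A B : primeT -> Prop) : (forall p, A p -> B p) -> U A -> U B.
Proof. by case: ultraU => _ [_ [mono _]] AB /mono; apply. Qed.

Lemma U_and A B : U A -> U B -> U (fun p => A p /\ B p).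
Proof. by case: ultraU => _ [_ [_ [andU _]]]; apply: andU. Qed.

Lemma U_pure (A : primeT -> Prop) : (forall p, A p) -> U A.
Proof. by case: ultraU => UT _ Ap; apply: U_mono UT => p _. Qed.

Lemma U_mono2 (A B G : primeT -> Prop) :
  (forall p, A p -> B p -> G p) -> U A -> U B -> U G.
Proof. by move=> ABG UA UB; apply: U_mono (U_and UA UB) => p []; apply: ABG. Qed.

Lemma U_all (I : finType) (A : I -> primeT -> Prop) :
  (forall i, U (A i)) -> U (fun p => forall i, A i p).
Proof.
move=> UA; suff: U (fun p => forall i, i \in enum I -> A i p).
  by apply: U_mono => p Ap i; apply: Ap; rewrite mem_enum.
elim: (enum I) => [|i s IHs]; first exact: U_pure.
apply: U_mono2 (UA i) IHs => p Aip As j; rewrite inE => /orP[/eqP->//|].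
exact: As.
Qed.

Lemma U_not A : ~ U A -> U (fun p => ~ A p).
Proof. by case: ultraU => _ [_ [_ [_ ultra]]] nUA; case: (ultra A). Qed.

Lemma not_U A : U (fun p => ~ A p) -> ~ U A.
Proof.
case: ultraU => _ [U0 _] UnA UA; apply: U0.
by apply: U_mono2 UA UnA => p.
Qed.

Lemma not_req (x y : prodF) : ~ req (x : M) y -> U (fun p => x p != y p).
Proof. by move/U_not; apply: U_mono => p /eqP. Qed.

Section DiffSubfield.
Variables (E : M -> Prop) (diffE : diff_subfield E).

Lemma E_req (x y : prodF) : U (fun p => x p = y p) -> E x -> E y.
Proof. by case: diffE => Er _; apply: Er. Qed.

Lemma E_ext (x y : prodF) : (forall p, x p = y p) -> E x -> E y.
Proof. by move=> eq_xy; apply/E_req/U_pure. Qed.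

Lemma E_0 : E (fun p => 0 : F p).
Proof. by case: diffE => _ [? _]. Qed.

Lemma E_1 : E (fun p => 1 : F p).
Proof. by case: diffE => _ [_ [? _]]. Qed.

Lemma E_add (x y : prodF) : E x -> E y -> E (fun p => x p + y p).
Proof. by case: diffE => _ [_ [_ [Ea _]]]; apply: Ea. Qed.

Lemma E_mul (x y : prodF) : E x -> E y -> E (fun p => x p * y p).
Proof. by case: diffE => _ [_ [_ [_ [Em _]]]]; apply: Em. Qed.

Lemma E_opp (x : prodF) : E x -> E (fun p => - x p).
Proof. by case: diffE => _ [_ [_ [_ [_ [Eo _]]]]]; apply: Eo. Qed.

Lemma E_inv (x : prodF) : E x -> E (fun p => (x p)^-1).
Proof. by case: diffE => _ [_ [_ [_ [_ [_ [Ei _]]]]]]; apply: Ei. Qed.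

Lemma E_frob (x : prodF) : E x -> E (fun p => x p ^+ val p).
Proof. by case: diffE => _ [_ [_ [_ [_ [_ [_ [Es _]]]]]]]; apply: Es. Qed.

Lemma E_unfrob (x : prodF) : E (fun p => x p ^+ val p) -> E x.
Proof. by case: diffE => _ [_ [_ [_ [_ [_ [_ [_ Es]]]]]]]; apply: Es. Qed.

Lemma E_unfrobX m (x : prodF) : E (fun p => x p ^+ (val p ^ m)) -> E x.
Proof.
elim: m x => [|m IHm] x Ex; first by apply: E_ext Ex => p; rewrite expn0.
by apply/IHm/E_unfrob/E_ext/Ex => p; rewrite -exprM -expnSr.
Qed.

Lemma E_exp m (x : prodF) : E x -> E (fun p => x p ^+ m).
Proof.
move=> Ex; elim: m => [|m IHm]; first exact: E_1.
by apply: E_ext (E_mul Ex IHm) => p; rewrite exprS.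
Qed.

Lemma E_sum (I : finType) (f : I -> prodF) :
  (forall i, E (f i)) -> E (fun p => \sum_i f i p).
Proof.
move=> Ef; elim: (index_enum I) => [|i s IHs].
  by apply: E_ext E_0 => p; rewrite big_nil.
by apply: E_ext (E_add (Ef i) IHs) => p; rewrite big_cons.
Qed.

(* Gaussian elimination: an unknown with a pivot different from 0 in the
   ultraproduct is eliminated from all the equations. *)
Lemma linear_dependence r s (A : 'I_s -> 'I_r -> prodF) :
    (r < s)%N -> (forall i j, E (A i j)) ->
  exists c : 'I_s -> prodF, [/\ forall i, E (c i),
    exists i, ~ req (c i : M) (r0 M) &
    forall j, U (fun p => \sum_i c i p * A i j p = 0)].
Proof.
elim: r s A => [|r IHr] s A lt_rs EA.
  exists (fun _ p => 1); split; [by move=> _; apply: E_1| |by case].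
  exists (Ordinal lt_rs); apply: not_U.
  by apply: U_pure => p; apply/eqP/oner_neq0.
have [[i0 nz_pivot] | no_pivot] := pselect (exists i, ~ req (A i ord0 : M) (r0 M)).
  case: s A lt_rs EA i0 nz_pivot => // s A lt_rs EA i0 nz_pivot.
  pose B i j p := A (lift i0 i) (lift ord0 j) p -
    A (lift i0 i) ord0 p / A i0 ord0 p * A i0 (lift ord0 j) p.
  have [||c [Ec [i1 nz_c] sol_c]] := IHr s B; first exact: lt_rs.
    move=> i j; apply: E_add => //; apply: E_opp.
    by apply: E_mul => //; apply: E_mul => //; apply: E_inv.
  pose c0 p := - (\sum_i c i p * A (lift i0 i) ord0 p) / A i0 ord0 p.
  pose d i p := if unlift i0 i is Some j then c j p else c0 p.
  have sumd j p : \sum_i d i p * A i j p =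
      c0 p * A i0 j p + \sum_i c i p * A (lift i0 i) j p.
    rewrite (bigD1_ord i0) //= /d unlift_none; congr (_ + _).
    by apply: eq_bigr => i _; rewrite liftK.
  exists d; split.
  - move=> i; rewrite /d; case: (unlift i0 i) => [j|]; first exact: Ec.
    apply: E_mul; last exact: E_inv.
    by apply: E_opp; apply: E_sum => j; apply: E_mul.
  - exists (lift i0 i1) => eq0; apply: nz_c.
    by apply: U_mono eq0 => p; rewrite /d liftK.
  - move=> j; case: (unliftP ord0 j) => [k ->|->].
      apply: U_mono2 (sol_c k) (not_req nz_pivot) => p; rewrite sumd => + nz.
      rewrite /B; under eq_bigr => i _ do rewrite mulrBr !mulrA.
      rewrite sumrB => /eqP; rewrite subr_eq0 => /eqP ->.
      by rewrite /c0 -!mulr_suml !mulNr addNr.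
    apply: U_mono (not_req nz_pivot) => p nz; rewrite sumd.
    by rewrite /c0 divfK ?addNr.
have [||c [Ec nz_c sol_c]] := IHr s (fun i j => A i (lift ord0 j)).
- exact: ltnW.
- by move=> i j; apply: EA.
exists c; split=> // j; case: (unliftP ord0 j) => [k ->|->]; first exact: sol_c.
have: U (fun p => forall i, A i ord0 p = 0).
  apply: U_all => i; apply: contrapT => nz; apply: no_pivot; by exists i.
by apply: U_mono => p A0; rewrite big1 // => i _; rewrite A0 mulr0.
Qed.

End DiffSubfield.

Hypothesis charF : forall p : primeT, val p \in [pchar F p].

Lemma frobD (p : primeT) m (x y : F p) :
  (x + y) ^+ (val p ^ m) = x ^+ (val p ^ m) + y ^+ (val p ^ m).
Proof.
elim: m => [|m IHm]; first by rewrite !expr1.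
rewrite expnSr !exprM IHm -!(pFrobenius_autE (charF p)); exact: rmorphD.
Qed.

Lemma frob0 (p : primeT) m : (0 : F p) ^+ (val p ^ m) = 0.
Proof. by rewrite expr0n expn_eq0 -leqn0 leqNgt prime_gt0 ?(valP p). Qed.

Lemma frobN (p : primeT) m (x : F p) : (- x) ^+ (val p ^ m) = - x ^+ (val p ^ m).
Proof. by apply/eqP; rewrite -subr_eq0 opprK -frobD addNr frob0. Qed.

Lemma frob_sum (p : primeT) m (I : finType) (f : I -> F p) :
  (\sum_i f i) ^+ (val p ^ m) = \sum_i f i ^+ (val p ^ m).
Proof. by apply: (big_morph _ (frobD m)); apply: frob0. Qed.

Lemma frob_eq0 (p : primeT) m (x : F p) : (x ^+ (val p ^ m) == 0) = (x == 0).
Proof. by rewrite expf_eq0 expn_gt0 prime_gt0 ?(valP p). Qed.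

Lemma frob_surj (p : primeT) m (x : F p) : exists y : F p, y ^+ (val p ^ m) = x.
Proof.
have inj : injective (fun y : F p => y ^+ (val p ^ m)).
  move=> y z /eqP; rewrite -subr_eq0 -frobN -frobD frob_eq0 subr_eq0.
  by move/eqP.
by exists (invF inj x); apply: (f_invF inj).
Qed.

(** * Upper bound on the transcendence degree; the degree of the theorem is [n.+1] here *)

Section TranscendenceDegree.
Variables (n : nat) (E : M -> Prop) (diffE : diff_subfield E) (a b : prodF).
Hypothesis Eb : E b.

(** The monomial with exponents [al] in [a, sigma a, ..., sigma^n a], which is a single power of [a]
    because [sigma] is Frobenius. *)
Definition monomial (al : nat -> nat) : prodF :=
  fun p => a p ^+ (\sum_(i < n.+1) al i * val p ^ i).

(** Polynomials over [E] in [a, ..., sigma^n a], of degree at most [d] in each. The first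
    constructor closes them under equality in the ultraproduct. *)
Inductive poly_span (d : nat) : prodF -> Prop :=
| poly_span_req x y of U (fun p => x p = y p) & poly_span d x : poly_span d y
| poly_span0 : poly_span d (fun=> 0)
| poly_spanD x y of poly_span d x & poly_span d y :
    poly_span d (fun p => x p + y p)
| poly_span_monomial e al of E e & (forall i, al i <= d)%N :
    poly_span d (fun p => e p * monomial al p).

Lemma poly_span_ext d (x y : prodF) :
  (forall p, x p = y p) -> poly_span d x -> poly_span d y.
Proof. by move=> eq_xy; apply/poly_span_req/U_pure. Qed.

Lemma poly_span_leq d d' x : (d <= d')%N -> poly_span d x -> poly_span d' x.
Proof.
move=> le_d; elim=> {x} [x y eq_xy _ + | |x y _ + _|e al Ee le_al].
- exact: poly_span_req.
- exact: poly_span0.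
- exact: poly_spanD.
- by apply: poly_span_monomial => // i; apply: leq_trans le_d.
Qed.

Lemma poly_span_const d e : E e -> poly_span d e.
Proof.
move=> Ee; apply: poly_span_ext (poly_span_monomial Ee (fun=> leq0n d)) => p.
by rewrite /monomial big1 ?mulr1.
Qed.

Lemma poly_spanM d d' x y :
  poly_span d x -> poly_span d' y -> poly_span (d + d') (fun p => x p * y p).
Proof.
move=> Vx Vy; elim: Vx => {x} [x x' eq_x _ | |x x' _ Vx _ Vx'|e al Ee le_al].
- by apply: poly_span_req; apply: U_mono eq_x => p ->.
- by apply: poly_span_ext (poly_span0 _) => p; rewrite mul0r.
- by apply: poly_span_ext (poly_spanD Vx Vx') => p; rewrite mulrDl.
elim: Vy => {y} [y y' eq_y _ | |y y' _ Vy _ Vy'|e' al' Ee' le_al'].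
- by apply: poly_span_req; apply: U_mono eq_y => p ->.
- by apply: poly_span_ext (poly_span0 _) => p; rewrite mulr0.
- by apply: poly_span_ext (poly_spanD Vy Vy') => p; rewrite mulrDr.
apply: poly_span_ext (poly_span_monomial (al := fun i => al i + al' i)%N
  (E_mul diffE Ee Ee') (fun i => leq_add _ _)) => // p.
rewrite mulrACA -exprD -big_split /monomial; congr (_ * _ ^+ _).
by apply: eq_bigr => i _; rewrite mulnDl.
Qed.

Lemma poly_spanX d x m : poly_span d x -> poly_span (m * d) (fun p => x p ^+ m).
Proof.
move=> Vx; elim: m => [|m IHm].
  by rewrite mul0n; exact: (poly_span_const 0 (E_1 diffE)).
by rewrite mulSn; apply: poly_span_ext (poly_spanM Vx IHm) => p; rewrite exprS.
Qed.

Lemma poly_span_prod (I : finType) d (x : I -> prodF) :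
  (forall i, poly_span d (x i)) -> poly_span (#|I| * d) (fun p => \prod_i x i p).
Proof.
move=> Vx; suff Vs (s : seq I) :
    poly_span (size s * d) (fun p => \prod_(i <- s) x i p).
  by rewrite cardE; apply: poly_span_ext (Vs (enum I)) => p; rewrite big_enum.
elim: s => [|i s IHs].
  by apply: poly_span_ext (poly_span_const 0 (E_1 diffE)) => p; rewrite big_nil.
by apply: poly_span_ext (poly_spanM (Vx i) IHs) => p; rewrite big_cons.
Qed.

Hypothesis sigma_a : U (fun p => a p ^+ (val p ^ n.+1) = b p * a p ^+ 2).

(** Frobenius shifts the exponents by one place, and [sigma^(n+1) a = b a^2] sends the last exponent
    back to [a], doubled, at the cost of a power of [b] in the coefficient. *)
Lemma poly_span_frob d x :
  poly_span d x -> poly_span (2 * d) (fun p => x p ^+ val p).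
Proof.
elim=> {x} [x y eq_xy _ | |x y _ Vx _ Vy|e al Ee le_al].
- by apply: poly_span_req; apply: U_mono eq_xy => p ->.
- by apply: poly_span_ext (poly_span0 _) => p; rewrite -[val p]expn1 frob0.
- apply: poly_span_ext (poly_spanD Vx Vy) => p.
  by rewrite -[val p]expn1 frobD.
pose al' i := if i is j.+1 then al j else (2 * al n)%N.
apply: (poly_span_req (x := fun p => (e p ^+ val p * b p ^+ al n) * monomial al' p)).
  apply: U_mono sigma_a => p eq_a; rewrite exprMn -mulrA; congr (_ * _).
  rewrite /monomial -exprM big_ord_recl big_ord_recr /= mulnDl exprD.
  rewrite expn0 muln1 exprD mulrA mulrC; congr (_ * _).
    congr (_ ^+ _); rewrite big_distrl; apply: eq_bigr => i _.
    by rewrite [RHS]/= -mulnA -expnSr.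
  by rewrite -mulnA -expnSr [in RHS]mulnC [RHS]exprM eq_a exprMn -exprM.
apply: poly_span_monomial; [|case=> [|i]]; last by apply: leq_trans (le_al i) _; lia.
  by apply: (E_mul diffE); [apply: E_frob|apply: E_exp].
by rewrite leq_mul2l le_al orbT.
Qed.

(** This normal form, a sum over a finite type of exponents, is what makes the monomials
    countable. *)
Lemma poly_span_coef d x : poly_span d x ->
  exists2 c : {ffun 'I_n.+1 -> 'I_d.+1} -> prodF, forall al, E (c al) &
    U (fun p => x p = \sum_al c al p * monomial (fun i => al (inord i)) p).
Proof.
elim=> {x} [x y eq_xy _ [c Ec sum_c]| |x y _ [c Ec sum_c] _ [c' Ec' sum_c']|e al Ee le_al].
- by exists c => //; apply: U_mono2 eq_xy sum_c => p ->.
- exists (fun _ _ => 0) => [_|]; first exact: E_0.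
  by apply: U_pure => p; rewrite big1 // => al _; rewrite mul0r.
- exists (fun al p => c al p + c' al p) => [al|]; first exact: E_add.
  apply: U_mono2 sum_c sum_c' => p -> ->.
  by rewrite -big_split; apply: eq_bigr => al _; rewrite mulrDl.
pose al0 : {ffun 'I_n.+1 -> 'I_d.+1} := [ffun i : 'I_n.+1 => inord (al i)].
exists (fun al' p => if al' == al0 then e p else 0) => [al'|].
  by case: eqP => _ //; apply: E_0.
apply: U_pure => p; rewrite (bigD1 al0) //= eqxx big1 ?addr0 => [|al' /negPf->].
  congr (_ * _ ^+ _); apply: eq_bigr => i _.
  by rewrite ffunE inord_val inordK // ltnS.
by rewrite mul0r.
Qed.

(* With [a_i = sigma^i a] and [sigma a_n = b * a_0 ^ 2], the difference field generated by [a] over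
   [E] is not generated by [a_0, ..., a_n] as a field: [sigma^-1 a_0] is only
   algebraic over it.  Hence the power [p ^ m] below. *)
Definition rational_at m (x : prodF) := exists d u v,
  [/\ poly_span d u, poly_span d v, U (fun p => v p != 0) &
      U (fun p => x p ^+ (val p ^ m) * v p = u p)].

Definition rational x := exists m, rational_at m x.

Lemma rational_atS m x : rational_at m x -> rational_at m.+1 x.
Proof.
case=> d [u [v [Vu Vv nz_v eq_x]]]; exists (2 * d)%N.
exists (fun p => u p ^+ val p), (fun p => v p ^+ val p).
split; try exact: poly_span_frob.
  by apply: U_mono nz_v => p; rewrite -[val p]expn1 frob_eq0.
by apply: U_mono eq_x => p <-; rewrite exprMn -exprM -expnSr.
Qed.

Lemma rational_at_leq m m' x : (m <= m')%N -> rational_at m x -> rational_at m' x.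
Proof.
by move/subnK=> <- Rx; elim: (m' - m)%N => //= i /rational_atS.
Qed.

Lemma rational_common (x y : prodF) (z : prodF) : rational x -> rational y ->
    (forall m, rational_at m x -> rational_at m y -> rational_at m z) ->
  rational z.
Proof.
case=> m Rx [m' Ry] Rz; exists (maxn m m'); apply: Rz.
  by apply: rational_at_leq Rx; apply: leq_maxl.
by apply: rational_at_leq Ry; apply: leq_maxr.
Qed.

Lemma rational_const e : E e -> rational e.
Proof.
move=> Ee; exists 0%N, 0%N, e, (fun p => 1); split.
- exact: poly_span_const.
- exact: (poly_span_const 0 (E_1 diffE)).
- by apply: U_pure => p; apply: oner_neq0.
- by apply: U_pure => p; rewrite mulr1.
Qed.

Lemma rational_gen : rational a.
Proof.
exists 0%N, 1%N, a, (fun p => 1); split.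
- apply: poly_span_ext (poly_span_monomial (al := fun i => i == 0%N) (E_1 diffE) _).
    move=> p; rewrite mul1r /monomial big_ord_recl big1 //=.
  by move=> i; rewrite leq_b1.
- exact: (poly_span_const 1 (E_1 diffE)).
- by apply: U_pure => p; apply: oner_neq0.
- by apply: U_pure => p; rewrite mulr1.
Qed.

(** Two elements are first brought to the same [m]. Then [sigma] acts on numerator and denominator,
    while its inverse only raises [m]. As [E] and [a] are included, so is the whole difference field
    generated by [a] and [b]. *)
Lemma rational_diff_subfield : diff_subfield (rational : M -> Prop).
Proof.
split; [|split; [|split; [|split; [|split; [|split; [|split; [|split]]]]]]].
- move=> x y eq_xy [m [d [u [v [Vu Vv nz_v eq_x]]]]]; exists m, d, u, v.
  by split=> //; apply: U_mono2 eq_xy eq_x => p ->.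
- exact: rational_const (E_0 diffE).
- exact: rational_const (E_1 diffE).
- move=> x y Rx Ry; apply: (rational_common Rx Ry) => m.
  case=> d [u [v [Vu Vv nz_v eq_x]]] [d' [u' [v' [Vu' Vv' nz_v' eq_y]]]].
  exists (d + d')%N, (fun p => u p * v' p + v p * u' p), (fun p => v p * v' p).
  split; [by apply: poly_spanD; apply: poly_spanM|exact: poly_spanM| |].
    by apply: U_mono2 nz_v nz_v' => p; apply: mulf_neq0.
  by apply: U_mono2 eq_x eq_y => p <- <- /=; rewrite frobD; ring.
- move=> x y Rx Ry; apply: (rational_common Rx Ry) => m.
  case=> d [u [v [Vu Vv nz_v eq_x]]] [d' [u' [v' [Vu' Vv' nz_v' eq_y]]]].
  exists (d + d')%N, (fun p => u p * u' p), (fun p => v p * v' p).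
  split; [exact: poly_spanM|exact: poly_spanM| |].
    by apply: U_mono2 nz_v nz_v' => p; apply: mulf_neq0.
  by apply: U_mono2 eq_x eq_y => p <- <- /=; rewrite exprMn mulrACA.
- move=> x [m [d [u [v [Vu Vv nz_v eq_x]]]]].
  exists m, d, (fun p => -1 * u p), v; split=> //.
    apply: (poly_spanM (d := 0)) => //; apply: poly_span_const.
    by apply: (E_opp diffE); apply: E_1.
  by apply: U_mono eq_x => p <- /=; rewrite frobN mulN1r mulNr.
- move=> x [m [d [u [v [Vu Vv nz_v eq_x]]]]].
  (* The inverse of 0 is 0 by convention, and only for [x] nonzero can the numerator become a
     denominator. *)
  have [x0|nz_x] := pselect (req (x : M) (r0 M)).
    exists m, d, (fun=> 0), v; split=> //; first exact: poly_span0.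
    by apply: U_mono x0 => p /= ->; rewrite invr0 frob0 mul0r.
  exists m, d, v, u; split=> //.
    apply: U_mono2 (U_and nz_v eq_x) (not_req nz_x) => p [nz_vp <-] nz_xp.
    by rewrite mulf_neq0 ?frob_eq0.
  apply: U_mono2 eq_x (not_req nz_x) => p <- /= nz_xp.
  by rewrite exprVn mulrA mulVf ?mul1r ?frob_eq0.
- move=> x [m [d [u [v [Vu Vv nz_v eq_x]]]]].
  exists m, (2 * d)%N, (fun p => u p ^+ val p), (fun p => v p ^+ val p).
  split; try exact: poly_span_frob.
    by apply: U_mono nz_v => p; rewrite -[val p]expn1 frob_eq0.
  by apply: U_mono eq_x => p <- /=; rewrite exprMn -!exprM mulnC.
- move=> x [m [d [u [v [Vu Vv nz_v eq_x]]]]]; exists m.+1, d, u, v; split=> //.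
  by apply: U_mono eq_x => p <- /=; rewrite -exprM expnS.
Qed.

Lemma alg_relationE k N (c : 'I_k -> M) (coef : {ffun 'I_k -> 'I_N.+1} -> M) p :
  (\big[@radd M / r0 M]_(al : {ffun 'I_k -> 'I_N.+1})
     rmul (coef al) (\big[@rmul M / r1 M]_(i < k) rpow (c i) (al i))) p =
  \sum_(al : {ffun 'I_k -> 'I_N.+1}) coef al p * \prod_(i < k) c i p ^+ al i.
Proof.
rewrite (big_morph (fun x : M => x p : F p) (id1 := 0) (op1 := +%R)) //.
apply: eq_bigr => al _ /=; congr (_ * _).
rewrite (big_morph (fun x : M => x p : F p) (id1 := 1) (op1 := *%R)) //.
apply: eq_bigr => i _; elim: (nat_of_ord (al i)) => //= m IHm.
by rewrite exprS -IHm.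
Qed.

(* There are more monomials of degree at most [N] in [n + 2] unknowns than
   monomials of degree at most [C * N] in the [n + 1] elements [sigma^i a],
   for [N] large. *)
Lemma rational_dependent (c : 'I_n.+2 -> M) :
  (forall i, rational (c i)) -> ~ alg_indep E c.
Proof.
move=> Rc.
have [m Rm] : exists m, forall i, rational_at m (c i).
  have /fin_all_exists[f Rf] := Rc; exists (\max_i f i) => i.
  by apply: rational_at_leq (Rf i); apply: leq_bigmax.
have [d Rd] : exists d, forall i, exists uv : prodF * prodF,
    [/\ poly_span d uv.1, poly_span d uv.2, U (fun p => uv.2 p != 0) &
        U (fun p => c i p ^+ (val p ^ m) * uv.2 p = uv.1 p)].
  have /fin_all_exists[f Rf] := Rm; exists (\max_i f i) => i.
  have [u [v [Vu Vv nz_v eq_x]]] := Rf i; exists (u, v).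
  by split=> //; apply: poly_span_leq (leq_bigmax i) _.
have /choice[uv {}Rd] := Rd.
(* [D] bounds the degrees of the monomials in the [c i] once denominators are cleared as in [w]. The
   choice of [N] gives [(D + 1)^(n+1) <= (C + 1)^(n+1) (N + 1)^(n+1) = N (N + 1)^(n+1) < (N +
   1)^(n+2)]. *)
pose C := (n.+2 * d)%N; pose N := ((C.+1) ^ n.+1)%N; pose D := (C * N)%N.
pose w (al : {ffun 'I_n.+2 -> 'I_N.+1}) p :=
  \prod_i ((uv i).1 p ^+ al i * (uv i).2 p ^+ (N - al i)).
have Vw al : poly_span D (w al).
  have -> : D = (#|'I_n.+2| * (N * d))%N by rewrite card_ord /D /C mulnA mulnAC.
  apply: poly_span_prod => i; have [Vu Vv _ _] := Rd i.
  have -> : (N * d = al i * d + (N - al i) * d)%N.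
    by rewrite -mulnDl subnKC // -ltnS.
  by apply: poly_spanM; apply: poly_spanX.
have /choice[coefw coefwP] : forall al, exists cf : {ffun 'I_n.+1 -> 'I_D.+1} -> prodF,
    (forall be, E (cf be)) /\
    U (fun p => w al p = \sum_be cf be p * monomial (fun i => be (inord i)) p).
  by move=> al; have [cf Ecf eqw] := poly_span_coef (Vw al); exists cf.
have lt_card : (#|{ffun 'I_n.+1 -> 'I_D.+1}| < #|{ffun 'I_n.+2 -> 'I_N.+1}|)%N.
  rewrite !card_ffun !card_ord.
  apply: (@leq_ltn_trans ((C.+1 * N.+1) ^ n.+1)).
    by rewrite leq_exp2r //; rewrite /D; nia.
  by rewrite expnMn [X in (_ < X)%N]expnS ltn_pmul2r ?expn_gt0.
have [|cf [Ecf [i0 nz_cf] sol_cf]] := linear_dependence diffE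
  (A := fun i j => coefw (enum_val i) (enum_val j)) lt_card.
  by move=> i j; have [? _] := coefwP (enum_val i).
pose e al : prodF := cf (enum_rank al).
(* The fractions represent the [p ^ m]-th powers of the [c i], so coefficients of a relation between
   the [c i] themselves are [p ^ m]-th roots; they stay in [E], which is closed under the inverse of
   [sigma]. *)
pose e' al p := sval (cid (frob_surj m (e al p))).
have e'P al p : e' al p ^+ (val p ^ m) = e al p := svalP (cid (frob_surj m (e al p))).
have sum_e : U (fun p => \sum_al e al p * w al p = 0).
  apply: U_mono2 (U_all (fun al => (coefwP al).2)) (U_all sol_cf) => p eqw sol.
  under eq_bigr => al _ do rewrite eqw big_distrr /=.
  rewrite exchange_big big1 //= => be _.
  under eq_bigr => al _ do rewrite mulrA.
  rewrite -big_distrl /= (_ : \sum_al _ = 0) ?mul0r //.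
  rewrite -[RHS](sol (enum_rank be)) enum_rankK.
  rewrite (reindex enum_rank) /=; last exact/onW_bij/enum_rank_bij.
  by apply: eq_bigr => al _; rewrite enum_rankK.
have sum_e' : U (fun p => \sum_al e' al p * \prod_i c i p ^+ al i = 0).
  have nz_v : U (fun p => forall i, (uv i).2 p != 0).
    by apply: U_all => i; case: (Rd i).
  have eq_c : U (fun p => forall i, c i p ^+ (val p ^ m) * (uv i).2 p = (uv i).1 p).
    by apply: U_all => i; case: (Rd i).
  apply: U_mono2 sum_e (U_and nz_v eq_c) => p {}sum_e [{}nz_v {}eq_c].
  apply/eqP; rewrite -(frob_eq0 m) frob_sum.
  have /mulIf inj_v : \prod_i (uv i).2 p ^+ N != 0.
    by apply/prodf_neq0 => i _; rewrite expf_neq0.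
  apply/eqP/inj_v; rewrite mul0r -[RHS]sum_e big_distrl /=.
  apply: eq_bigr => al _; rewrite exprMn e'P -mulrA; congr (_ * _).
  rewrite -prodrXl -big_split; apply: eq_bigr => i _ /=.
  rewrite -eq_c exprMn -mulrA -exprD subnKC; last by rewrite -ltnS.
  by rewrite -!exprM mulnC.
move=> indep; apply: nz_cf.
have e'0 : req (e' (enum_val i0) : M) (r0 M).
  apply: (indep N e').
    move=> al; apply: (E_unfrobX diffE (m := m)).
    apply: E_ext (Ecf (enum_rank al)) => // p; exact/esym/e'P.
  by apply: U_mono sum_e' => p; apply: etrans (alg_relationE _ _ _).
apply: U_mono e'0 => p /= /eqP; rewrite -(frob_eq0 m) e'P /e enum_valK.
by move/eqP.
Qed.
End TranscendenceDegree.

(** * Lower bound: algebraic independence of [a, ..., sigma^(n-1) a] *)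

Section TranscendenceDegreeLower.
Variables (n : nat) (iota : forall p : primeT, {rmorphism 'F_(val p) -> F p}) (a : prodF).
Hypothesis n_gt0 : (0 < n)%N.
Hypothesis U_large : forall m, U (fun p => (m < val p)%N).
Hypothesis generic_a : forall (p : primeT) (P : {poly 'F_(val p)}),
  P != 0 -> (size P <= val p ^ val p)%N -> (map_poly (iota p) P).[a p] != 0.

Implicit Types p : primeT.

Let b : prodF := fun p => a p ^+ (val p ^ n - 2).
Local Notation evb p P := (map_poly (iota p) P).[b p].

Lemma prime_odd_large p : (2 < val p)%N -> odd (val p).
Proof. by case: (even_prime (valP p)) => [->|]. Qed.

Lemma size_comp_Xn_leq p s (P : {poly 'F_(val p)}) : (size P <= val p ^ s)%N ->
  (size (P \Po 'X^(val p ^ n - 2)) <= val p ^ (s + n))%N.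
Proof.
move=> leP; apply: leq_trans (size_comp_poly_leq _ _) _.
rewrite size_polyXn succnK expnD; move: leP.
have : (0 < val p ^ s)%N by rewrite expn_gt0 prime_gt0 ?(valP p).
have : (0 < val p ^ n)%N by rewrite expn_gt0 prime_gt0 ?(valP p).
move: (val p ^ s)%N (val p ^ n)%N => A B; nia.
Qed.

Lemma evbE p (P : {poly 'F_(val p)}) :
  evb p P = (map_poly (iota p) (P \Po 'X^(val p ^ n - 2))).[a p].
Proof. by rewrite map_comp_poly map_polyXn horner_comp hornerXn. Qed.

Lemma expn_sub2_gt0 p : (2 < val p)%N -> (0 < val p ^ n - 2)%N.
Proof.
move=> p_gt2; rewrite subn_gt0 (leq_trans p_gt2) //.
by rewrite -{1}(expn1 (val p)) leq_exp2l // ltnW.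
Qed.

(** Substituting [X^N] for [X], with [N = p^n - 2], turns a polynomial in [b] into one in [a] of
    size at most [p ^ (s + n)], which is within the range where [a] is generic. *)
Lemma evb_neq0 p s (Q : {poly 'F_(val p)}) :
    (2 < val p)%N -> (s + n <= val p)%N -> Q != 0 -> (size Q <= val p ^ s)%N ->
  evb p Q != 0.
Proof.
move=> p_gt2 le_p nzQ leQ; rewrite evbE; apply: generic_a.
  by rewrite comp_poly_eq0 // size_polyXn ltnS expn_sub2_gt0.
apply: leq_trans (size_comp_Xn_leq leQ) _.
by rewrite leq_exp2l // prime_gt1 ?(valP p).
Qed.

(** Sizes are measured by the exponent [s] of a power of [p], since a Frobenius multiplies them by
    about [p]. *)
Definition b_fraction m s (x : prodF) p := exists P Q : {poly 'F_(val p)},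
  [/\ (size P <= val p ^ s)%N, (size Q <= val p ^ s)%N, Q != 0 &
      x p ^+ (val p ^ m) * evb p Q = evb p P].

Lemma b_fraction_leq m s s' x p :
  (s <= s')%N -> b_fraction m s x p -> b_fraction m s' x p.
Proof.
move=> le_s [P [Q [szP szQ nzQ eqx]]]; exists P, Q.
have le_ps : (val p ^ s <= val p ^ s')%N by rewrite leq_pexp2l ?prime_gt0 ?(valP p).
by split=> //; apply: leq_trans le_ps.
Qed.

Lemma evb_frob p (P : {poly 'F_(val p)}) : evb p (P ^+ val p) = evb p P ^+ val p.
Proof. by rewrite rmorphXn horner_exp. Qed.

Lemma size_frob p s (P : {poly 'F_(val p)}) :
  (size P <= val p ^ s)%N -> (size (P ^+ val p) <= val p ^ s.+1)%N.
Proof.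
move=> leP; apply: leq_trans (size_poly_exp_leq _ _) _.
have := prime_gt0 (valP p); have : (0 < val p ^ s)%N by rewrite expn_gt0 prime_gt0 ?(valP p).
rewrite expnS; move: leP; move: (val p ^ s)%N => A; nia.
Qed.

Lemma b_fraction_frob m s (x : prodF) p (y : F p) :
    x p ^+ (val p ^ m) ^+ val p = y ->
  b_fraction m s x p -> exists P Q : {poly 'F_(val p)},
  [/\ (size P <= val p ^ s.+1)%N, (size Q <= val p ^ s.+1)%N, Q != 0 &
      y * evb p Q = evb p P].
Proof.
move=> <- [P [Q [szP szQ nzQ eqx]]]; exists (P ^+ val p), (Q ^+ val p).
split; [exact: size_frob|exact: size_frob|exact: expf_neq0|].
by rewrite !evb_frob -eqx exprMn.
Qed.

Lemma b_fractionS m s x p : b_fraction m s x p -> b_fraction m.+1 s.+1 x p.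
Proof.
by move=> fx; apply: b_fraction_frob fx; rewrite -exprM -expnSr.
Qed.

Lemma b_fraction_addn j m s x p :
  b_fraction m s x p -> b_fraction (j + m) (j + s) x p.
Proof. by move=> fx; elim: j => //= j /b_fractionS. Qed.

(** Here [m] and [s] are independent of [p], so that the sizes fall below [p ^ p] for all large
    [p]. *)
Definition b_rational (x : prodF) := exists m s, U (b_fraction m s x).

Lemma b_rational_common (x y z : prodF) : b_rational x -> b_rational y ->
    (forall m s p, b_fraction m s x p -> b_fraction m s y p ->
       b_fraction m (s + s) z p) ->
  b_rational z.
Proof.
move=> [m [s fx]] [m' [s' fy]] fz.
pose t := ((m' + s) + (m + s'))%N; exists (m + m')%N, (t + t)%N.
apply: U_mono2 fx fy => p fx fy; apply: fz.
  apply: (@b_fraction_leq _ (m' + s)); first exact: leq_addr.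
  by rewrite addnC; apply: b_fraction_addn.
apply: (@b_fraction_leq _ (m + s')); first exact: leq_addl.
exact: b_fraction_addn.
Qed.

Lemma b_rational_poly (x : prodF) (P : forall p : primeT, {poly 'F_(val p)}) :
  (forall p, size (P p) <= 2)%N -> (forall p, x p = evb p (P p)) -> b_rational x.
Proof.
move=> szP eq_x; exists 0%N, 1%N; apply: U_pure => p; exists (P p), 1.
have p_gt1 := prime_gt1 (valP p).
split; [exact: leq_trans p_gt1| |exact: oner_neq0|].
  by rewrite size_poly1 ltnW.
by rewrite rmorph1 hornerC mulr1 -eq_x.
Qed.

Lemma b_rational_diff_subfield : diff_subfield (b_rational : M -> Prop).
Proof.
have gt0 (p : primeT) s : (0 < val p ^ s)%N by rewrite expn_gt0 prime_gt0 ?(valP p).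
split; [|split; [|split; [|split; [|split; [|split; [|split; [|split]]]]]]].
- move=> x y eq_xy [m [s fx]]; exists m, s.
  by apply: U_mono2 eq_xy fx => p eq_xy [P [Q [*]]]; exists P, Q; rewrite -eq_xy.
- apply: (b_rational_poly (P := fun=> 0)) => p; first by rewrite size_poly0.
  by rewrite rmorph0 horner0.
- apply: (b_rational_poly (P := fun=> 1)) => p; first by rewrite size_poly1.
  by rewrite rmorph1 hornerC.
- move=> x y Rx Ry; apply: (b_rational_common Rx Ry) => m s p.
  case=> P [Q [szP szQ nzQ eqx]] [P' [Q' [szP' szQ' nzQ' eqy]]].
  exists (P * Q' + Q * P'), (Q * Q'); rewrite expnD size_mul_leq_mul ?mulf_neq0 //.
  rewrite (leq_trans (size_polyD _ _)) ?geq_max ?size_mul_leq_mul //; split=> //.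
  by rewrite rmorphD hornerD !rmorphM !hornerM -eqx -eqy /= frobD; ring.
- move=> x y Rx Ry; apply: (b_rational_common Rx Ry) => m s p.
  case=> P [Q [szP szQ nzQ eqx]] [P' [Q' [szP' szQ' nzQ' eqy]]].
  exists (P * P'), (Q * Q'); rewrite expnD !size_mul_leq_mul ?mulf_neq0 //.
  by split=> //; rewrite !rmorphM !hornerM -eqx -eqy exprMn mulrACA.
- move=> x [m [s fx]]; exists m, s; apply: U_mono fx => p [P [Q [szP szQ nzQ eqx]]].
  exists (- P), Q; rewrite size_polyN; split=> //.
  by rewrite rmorphN hornerN -eqx /= frobN mulNr.
- move=> x [m [s fx]]; exists m, s.
  apply: U_mono2 fx (U_and (U_large 2) (U_large (s + n))) => p.
  move=> [P [Q [szP szQ nzQ eqx]]] [p_gt2 /ltnW le_p].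
  (* Genericity of [a] keeps the denominator nonzero at [b]; hence a nonzero [x] has a nonzero
     numerator and the fraction can be inverted. *)
  have nz_evQ := evb_neq0 p_gt2 le_p nzQ szQ.
  have [x0|nz_x] := eqVneq (x p) 0.
    exists 0, 1; rewrite size_poly0 size_poly1 /= x0 invr0 frob0 mul0r.
    by rewrite rmorph0 horner0 oner_neq0 gt0.
  exists Q, P; split=> //.
    apply: contraNneq nz_x => P0; rewrite -(frob_eq0 m).
    move: eqx; rewrite P0 rmorph0 horner0 => /eqP.
    by rewrite mulf_eq0 (negPf nz_evQ) orbF.
  by rewrite -eqx /= exprVn mulrA mulVf ?mul1r ?frob_eq0.
- move=> x [m [s fx]]; exists m, s.+1; apply: U_mono fx => p.
  by apply: b_fraction_frob; rewrite /= -!exprM mulnC.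
- move=> x [m [s fx]]; exists m.+1, s; apply: U_mono fx => p [P [Q [*]]].
  by exists P, Q; split=> //; rewrite expnS exprM.
Qed.

(** A relation, raised to the power [p ^ m] and cleared of denominators, says that a polynomial of
    size at most [p ^ p] over the prime field vanishes at [a]. That polynomial is then 0, and its
    terms separate modulo [N]. *)
Lemma sigma_alg_indep :
  alg_indep (gen_diff (fun x => List.In x [:: (b : M)]))
    (fun i : 'I_n => (fun p => a p ^+ (val p ^ i)) : M).
Proof.
move=> d coef Ecoef sum0.
have Rcoef al : b_rational (coef al).
  apply: Ecoef; first exact: b_rational_diff_subfield.
  move=> _ [<-|//]; apply: (b_rational_poly (P := fun=> 'X)) => p.
    by rewrite size_polyX.
  by rewrite map_polyX hornerX.
have [m {}Rcoef] : exists m, forall al, exists s, U (b_fraction m s (coef al)).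
  have /fin_all_exists[f Rf] := Rcoef; exists (\max_al f al) => al.
  have [s Us] := Rf al; exists ((\max_al f al - f al) + s)%N.
  rewrite -[X in b_fraction X](subnK (leq_bigmax al)).
  by apply: U_mono Us => p; apply: b_fraction_addn.
have [s {}Rcoef] : exists s, forall al, U (b_fraction m s (coef al)).
  have /fin_all_exists[f Rf] := Rcoef; exists (\max_al f al) => al.
  by apply: U_mono (Rf al) => p; apply: b_fraction_leq; apply: leq_bigmax.
(* [p ^ S] will bound the size of the final polynomial: [T * s] for a numerator times the other
   denominators, [n] for substituting [X^N], and [m + n] for the monomial in [a]. *)
pose T := #|{ffun 'I_n -> 'I_d.+1}|; pose S := (T * s + n + (m + n))%N.
suff: U (fun p => forall al, coef al p = 0).
  by move=> coef0 al; apply: U_mono coef0 => p; apply.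
apply: U_mono2 (U_and sum0 (U_all Rcoef))
  (U_and (U_large (s + n)) (U_and (U_large S) (U_large (d + 2)))) => p.
rewrite alg_relationE => -[{}sum0 {}Rcoef] [ltn_s [lt_S lt_d]].
have p_gt2 : (2 < val p)%N by lia.
have /fin_all_exists[P /fin_all_exists[Q PQ]] := Rcoef.
pose N := (val p ^ n - 2)%N.
pose eps (al : {ffun 'I_n -> 'I_d.+1}) := (\sum_(i < n) al i * val p ^ i)%N.
(* The numerator of the coefficient at [al] over the common denominator. *)
pose H al := P al * \prod_(be | be != al) Q be.
have gt0 k : (0 < val p ^ k)%N by rewrite expn_gt0 prime_gt0 ?(valP p).
have small_digits (al : {ffun 'I_n -> 'I_d.+1}) i : (al i + 2 < val p)%N.
  by have := ltn_ord (al i); lia.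
have lt_eps al : (eps al < N)%N by apply: small_digit_sum_ltn.
have nz_evQ al : evb p (Q al) != 0.
  by have [_ szQ nzQ _] := PQ al; apply: evb_neq0 szQ => //; lia.
have evH al : evb p (H al) = coef al p ^+ (val p ^ m) * \prod_be evb p (Q be).
  have [_ _ _ eq_coef] := PQ al.
  rewrite rmorphM hornerM -eq_coef -mulrA [in RHS](bigD1 al) //=; congr (_ * (_ * _)).
  by rewrite rmorph_prod horner_prod.
have inj_eps al be : val p ^ m * eps al = val p ^ m * eps be %[mod N] -> al = be.
  move/(mulp_mod_inj (prime_odd_large p_gt2) (ltnW p_gt2) n_gt0 (lt_eps _) (lt_eps _)).
  move/digit_sum_inj => eq_al; apply/ffunP => i; apply/val_inj/eq_al => j.
    by have := small_digits al j; lia.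
  by have := small_digits be j; lia.
suff G0 : \sum_al (H al \Po 'X^N) * 'X^(val p ^ m * eps al) = 0.
  move=> al; apply/eqP; rewrite -(frob_eq0 m); have := evH al.
  rewrite (graded_sum_eq0 (expn_sub2_gt0 p_gt2) inj_eps G0 al) rmorph0 horner0 => /esym/eqP.
  by rewrite mulf_eq0 => /orP[//|/prodf_eq0[be _]]; rewrite (negPf (nz_evQ be)).
apply/eqP; apply: contraT => nzG.
have szG : (size (\sum_al (H al \Po 'X^N) * 'X^(val p ^ m * eps al))%R
    <= val p ^ val p)%N.
  apply: (@leq_trans (val p ^ S)); last by rewrite leq_exp2l ?prime_gt1 ?(valP p) // ltnW.
  apply: leq_trans (size_sum _ _ _) _; apply/bigmax_leqP => al _.
  rewrite /S expnD size_mul_leq_mul //.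
    apply: size_comp_Xn_leq; have [szP _ _ _] := PQ al.
    have -> : T = #|[pred be | be != al]|.+1.
      rewrite (@eq_card _ _ (predC1 al)) // cardC1 prednK //.
      by apply/card_gt0P; exists al.
    rewrite mulSn expnD size_mul_leq_mul // mulnC expnM.
    by apply: size_prod_leq_exp => // be; have [] := PQ be.
  rewrite size_polyXn expnD; apply: leq_trans (_ : val p ^ m * (eps al).+1 <= _)%N.
    by rewrite mulnS; have := gt0 m; lia.
  by rewrite leq_mul2l (leq_trans (lt_eps al)) ?leq_subr ?orbT.
(* The value at [a] is the product of all denominators times the [p ^ m]-th power of the given
   relation, hence 0. *)
case/eqP: (generic_a nzG szG); rewrite rmorph_sum horner_sum.
rewrite (eq_bigr (fun al => (\prod_be evb p (Q be)) *
   (coef al p * \prod_(i < n) (a p ^+ (val p ^ i)) ^+ al i) ^+ (val p ^ m))).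
  by rewrite -big_distrr -frob_sum /= sum0 frob0 mulr0.
move=> al _; rewrite rmorphM hornerM -evbE evH rmorphXn horner_exp.
rewrite [X in X.[a p]]map_polyX hornerX.
rewrite exprMn [RHS]mulrCA [RHS]mulrA mulnC exprM; congr (_ * _ ^+ _).
by rewrite /eps expr_sum; apply: eq_bigr => i _; rewrite -exprM mulnC.
Qed.
End TranscendenceDegreeLower.
End Ultraproduct.

(** * Generated difference fields and the ultrafilter on primes *)

Lemma gen_diff_subfield (M : Lstruct) (S : M -> Prop) : diff_subfield (gen_diff S).
Proof.
have mem X x : diff_subfield X -> (forall s, S s -> X s) -> gen_diff S x -> X x.
  by move=> dX SX; apply.
split; [|split; [|split; [|split; [|split; [|split; [|split; [|split]]]]]]].
- by move=> x y exy Gx X dX SX; case: (dX) => h _; apply: (h _ _ exy); apply: mem.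
- by move=> X [_ [? _]].
- by move=> X [_ [_ [? _]]].
- by move=> x y Gx Gy X dX SX; case: (dX) => _ [_ [_ [h _]]]; apply: h; apply: mem.
- by move=> x y Gx Gy X dX SX; case: (dX) => _ [_ [_ [_ [h _]]]]; apply: h; apply: mem.
- by move=> x Gx X dX SX; case: (dX) => _ [_ [_ [_ [_ [h _]]]]]; apply: h; apply: mem.
- by move=> x Gx X dX SX; case: (dX) => _ [_ [_ [_ [_ [_ [h _]]]]]]; apply: h; apply: mem.
- by move=> x Gx X dX SX; case: (dX) => _ [_ [_ [_ [_ [_ [_ [h _]]]]]]]; apply: h; apply: mem.
- by move=> x Gx X dX SX; case: (dX) => _ [_ [_ [_ [_ [_ [_ [_ h]]]]]]]; apply: h; apply: mem.
Qed.

(** The sets containing all large primes form a proper filter, since primes are unbounded; any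
    ultrafilter extending it will do. *)
Lemma exists_ultrafilter : exists U : (primeT -> Prop) -> Prop,
  ultrafilter U /\ forall m, U (fun p => m < val p).
Proof.
pose G : set_system primeT := fun A => exists m, forall p : primeT, m < val p -> A p.
have [|U [ultraU GU]] := @ultraFilterLemma _ G.
  split; last split.
  - case=> m A0; have [p lt_mp pr_p] := prime_above m.
    exact: (A0 (exist _ p pr_p) lt_mp).
  - by exists 0.
  - move=> A B [m Am] [m' Bm']; exists (maxn m m') => p.
    by rewrite gtn_max => /andP[/Am ? /Bm' ?].
  - by move=> A B AB [m Am]; exists m => p /Am/AB.
have properU := @ultra_proper _ _ ultraU.
exists U; split; last by move=> m; apply: GU; exists m.
split; [|split; [|split; [|split]]].
- exact: filterT.
- exact: filter_not_empty.
- by move=> A B UA AB; apply: filterS UA.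
- by move=> A B; apply: filterI.
- by move=> A; apply: in_ultra_setVsetC.
Qed.

(** * Choice of the finite fields and of the generic elements *)

Local Open Scope ring_scope.

(** The data of one component, bundled so that it can be chosen prime by prime; [P] will be the
    lower bound [ge_f] on the degree. *)
Record generic_field (n p : nat) (P : nat -> Prop) := GenericField {
  gf_field : finFieldType;
  gf_deg : nat;
  gf_emb : {rmorphism 'F_p -> gf_field};
  gf_elt : gf_field;
  gf_pchar : p \in [pchar gf_field];
  gf_card : #|gf_field| = (p ^ gf_deg)%N;
  gf_degP : P gf_deg;
  gf_sqr : odd p -> forall u : gf_field, u != 0 -> u ^+ (p ^ n) = u ^+ 2 -> u = 1;
  gf_generic : forall Q : {poly 'F_p}, Q != 0 -> (size Q <= p ^ p)%N ->
    (map_poly gf_emb Q).[gf_elt] != 0 }.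

Lemma generic_field_exists n p (P : nat -> Prop) :
    prime p -> (0 < n)%N -> (exists K, forall k, (K <= k)%N -> P k) ->
  exists _ : generic_field n p P, True.
Proof.
move=> pr_p n_gt0 [K PK]; have p_gt1 := prime_gt1 pr_p.
have [d def_d] : exists d, d = (p ^ p)%N by exists (p ^ p)%N.
(* The totient makes [2 ^ j] equal to 1 modulo [p ^ n - 2]; [.-1.+1] replaces a possible 0 by 1. The
   summand [K] serves [P], and [d + d] makes the field large enough to contain a generic element. *)
pose j := ((totient (p ^ n - 2)).-1.+1 * (K + (d + d)))%N.
have le_j : (K + (d + d) <= n * j.+1)%N.
  by rewrite (leq_trans (leq_pmull _ (ltn0Sn (totient (p ^ n - 2)).-1))) // -/j; nia.
have [F charF cardF] := @pPrimePowerField p (n * j.+1) pr_p ltac:(nia).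
have [iota _] := rmorph_Fp charF.
have [|a generic_a] := @exists_not_root _ _ iota d.
  have lt_d : (d * p ^ d < p ^ (d + d))%N.
    rewrite expnD ltn_mul2r (ltn_expl _ p_gt1) andbT expn_gt0.
    by rewrite (ltnW p_gt1).
  rewrite card_Fp // cardF; apply: leq_trans lt_d _.
  by rewrite leq_exp2l // (leq_trans _ le_j) // leq_addl.
suff sqr : odd p -> forall u : F, u != 0 -> u ^+ (p ^ n) = u ^+ 2 -> u = 1.
  rewrite def_d in generic_a.
  by exists (GenericField charF cardF (PK _ (leq_trans (leq_addr _ _) le_j)) sqr generic_a).
move=> p_odd u; apply: (expf_p_eq_sqr p_odd p_gt1 n_gt0 cardF).
rewrite /j prednK ?dvdn_mulr // totient_gt0 subn_gt0.
have p_gt2 : (2 < p)%N by lia.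
by rewrite (leq_trans p_gt2) // -{1}(expn1 p) leq_exp2l.
Qed.

(** * The defining formula and the conclusion *)

Definition sqr_formula n := fand
  (feq (iter n tsig (tvar 0)) (tmul (tvar 1) (tmul (tvar 0) (tvar 0))))
  (fnot (feq (tvar 0) tzero)).

Lemma sqr_formula_wf n : pwf (PForm 1 1 (sqr_formula n)).
Proof.
rewrite /pwf /= all_cat; suff -> : tfv (iter n tsig (tvar 0)) = [:: 0%N] by [].
by elim: n.
Qed.

Lemma sat_sqr_formula F U n (x y : ustruct F U) :
  sat (envs [:: x; y]) (sqr_formula n) <->
  U (fun p => x p ^+ (val p ^ n) = y p * (x p * x p)) /\ ~ U (fun p => x p = 0).
Proof.
have eval_iter : teval (envs [:: x; y]) (iter n tsig (tvar 0)) =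
    ((fun p => x p ^+ (val p ^ n)) : ustruct F U).
  apply: functional_extensionality_dep => p; elim: n => [|n IHn] /=.
    by rewrite expr1.
  by rewrite IHn -exprM -expnSr.
by rewrite /sqr_formula /= eval_iter.
Qed.

Theorem theorem4p6
  (C : pform -> R) (D : pform -> list (nat * R)) (HCD : valid_CD C D)
  (n : nat) (Hn : (0 < n)%N) :
  exists (F : primeT -> finFieldType) (k : primeT -> nat)
         (U : (primeT -> Prop) -> Prop),
    ultrafilter U /\ nonprincipal U /\
    (forall p : primeT, #|F p| = (val p ^ k p)%N) /\
    (forall p : primeT, ge_f C D (val p) (val p) (k p)) /\
    exists (a : ustruct F U) (b : seq (ustruct F U)),
      dcl b a /\ deg_sigma_eq a b n.
Proof.
(* From here on the degree is [n.+1], as in the upper bound. *)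
case: n Hn => // n Hn.
pose f (p : primeT) : generic_field n.+1 (val p) (ge_f C D (val p) (val p)) :=
  sval (cid (generic_field_exists (valP p) Hn (exists_ge_f C D (val p) (val p)))).
have [U [ultraU U_large]] := exists_ultrafilter.
exists (fun p => gf_field (f p)), (fun p => gf_deg (f p)), U.
split=> //; split.
  move=> p Up; apply: (not_U ultraU _ (U_large (val p))).
  by apply: U_mono Up => // q ->; rewrite ltnn.
split; first by move=> p; apply: gf_card.
split; first by move=> p; apply: gf_degP.
pose F (p : primeT) := gf_field (f p).
pose a (p : primeT) : F p := gf_elt (f p).
pose b (p : primeT) : F p := a p ^+ (val p ^ n.+1 - 2).
have charF (p : primeT) : val p \in [pchar F p] := gf_pchar (f p).
have generic_a (p : primeT) (Q : {poly 'F_(val p)}) : Q != 0 ->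
    (size Q <= val p ^ val p)%N -> (map_poly (gf_emb (f p)) Q).[a p] != 0.
  exact: gf_generic.
have nz_a (p : primeT) : a p != 0.
  have := generic_a p 'X; rewrite map_polyX hornerX size_polyX polyX_eq0; apply=> //.
  have p_gt1 := prime_gt1 (valP p).
  by rewrite (leq_trans p_gt1) // -{1}(expn1 (val p)) leq_exp2l // ltnW.
have sigma_a : U (fun p => a p ^+ (val p ^ n.+1) = b p * a p ^+ 2).
  apply: U_mono (U_large 2) => // p p_gt2; rewrite /b -exprD subnK //.
  by have := expn_sub2_gt0 Hn p_gt2; rewrite subn_gt0 => /ltnW.
exists (a : ustruct F U), [:: (b : ustruct F U)]; split.
  exists (sqr_formula n.+1); split; first exact: sqr_formula_wf.
  split.
    apply/sat_sqr_formula; split; first by apply: U_mono sigma_a => // p; rewrite -expr2.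
    by apply/(not_U ultraU)/(U_pure ultraU) => p; apply/eqP/nz_a.
  move=> a' /sat_sqr_formula[sigma_a' /(not_req ultraU) nz_a'].
  apply: (U_mono2 ultraU _ (U_and ultraU sigma_a sigma_a') (U_and ultraU nz_a' (U_large 2))).
  move=> p [eq_a eq_a'] [{}nz_a' p_gt2].
  (* The parameter [b] cancels in the quotient of two solutions, which is therefore a nonzero [u]
     with [u ^+ (p ^ n.+1) = u ^+ 2]. *)
  suff eq1 : a' p / a p = 1 by rewrite -[LHS](divfK (nz_a p)) eq1 mul1r.
  apply: (gf_sqr (prime_odd_large p_gt2)); first exact: mulf_neq0 nz_a' (invr_neq0 (nz_a p)).
  rewrite !exprMn !exprVn eq_a eq_a' -expr2 invfM mulrACA mulfV ?mul1r //.
  exact: expf_neq0 (nz_a p).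
split.
  exists (fun i : 'I_n.+1 => (fun p => a p ^+ (val p ^ i)) : ustruct F U); split.
    move=> i X dX SX; have Xa : X a by apply: SX; left.
    elim: (nat_of_ord i) => [|m IHm]; first by apply: E_ext Xa => // p; rewrite expr1.
    by apply: E_ext (E_frob dX IHm) => // p; rewrite -exprM -expnSr.
  exact: (sigma_alg_indep ultraU charF Hn U_large generic_a).
move=> c Kc.
have dE := gen_diff_subfield (fun x : ustruct F U => List.In x [:: (b : ustruct F U)]).
have Eb : gen_diff (fun x : ustruct F U => List.In x [:: (b : ustruct F U)]) b.
  by move=> X _; apply; left.
apply: (rational_dependent ultraU charF dE Eb sigma_a) => i.
apply: Kc; first exact: (rational_diff_subfield ultraU charF dE Eb sigma_a).
move=> x [->|[<-|[]]]; first by apply: rational_gen.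
by apply: rational_const.
Qed.
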